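(* Let $E=\{(0,0)\}$, $\mu=\delta_{(0,0)}$, and, on a sufficiently small corner chart, set $u((0,0);x,y,z)=\dfrac1{x^2+y^2}$. Then $A_\mu=0$ and $$\int^\infty\sqrt{\mathcal T_\mu(S)}\,dS=\int^\infty e^{-S}\,dS<\infty,$$ but every curve approaching the corner has infinite $g_\mu$-length. Hence the completion fibre over every corner point is empty.
   Context: Let $k\ge0$, let $V\subset\mathbb R^k$ be open, $0<\varepsilon<1$ sufficiently small, $U=[0,\varepsilon)^2\times V$ with coordinates $(x,y,z)$, and let $g_0$ be a smooth Riemannian metric on $U$ with $c_0g_{\mathrm E}\le g_0\le C_0g_{\mathrm E}$, where $g_{\mathrm E}$ is the Euclidean metric and $0<c_0\le C_0<\infty$. Let $B$ be a Euclidean ball relatively compact in $V$ and $U_B=(0,\varepsilon)^2\times B$. For a finite positive measure $\mu$ with compact support $E$ and a positive coefficient $u(\alpha;x,y,z)$, put $F_\mu(x,y,z)=\int_E u(\alpha;x,y,z)x^{-\alpha_1}y^{-\alpha_2}\,d\mu(\alpha)$, $g_\mu=F_\mu g_0$, and let $d_\mu$ be the infimum of $g_\mu$-lengths of absolutely continuous curves in $U_B$. Put $A_\mu=\max_{\alpha\in E}(\alpha_1+\alpha_2)$ and $\mathcal T_\mu(S)=\int_E e^{-S(2-\alpha_1-\alpha_2)}\,d\mu(\alpha)$. A curve approaching the corner is an absolutely continuous curve in $U_B$ with $x\to0$ and $y\to0$ along one end. The completion fibre over $p\in\{x=y=0\}\times B$ is the set of points of the metric completion of $(U_B,d_\mu)$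 represented by $d_\mu$-Cauchy sequences in $U_B$ converging Euclideanly to $p$. (Here $u$ is not bounded above.) $\int^\infty$ means the integral over $[S_0,\infty)$ for some $S_0\ge0$. *)

(* Defs.v *)
From HB Require Import structures.
From mathcomp Require Import all_boot all_order all_algebra.
From mathcomp Require Import all_classical all_reals all_analysis.

Set Implicit Arguments.
Unset Strict Implicit.
Unset Printing Implicit Defensive.

Import Order.TTheory GRing.Theory Num.Theory.
Import numFieldNormedType.Exports.

Local Open Scope classical_set_scope.
Local Open Scope ring_scope.

(* A point (x, y, z) of R^2 x R^k is the row vector of size 2 + k whose first
   two entries are x and y.  The library norm of a row vector is the sup norm;
   it is used only where equivalent norms agree (topology, differentiability,
   absolute continuity).  The Euclidean norm is [enorm]. *)

Section Coordinates.
Context {R : realType} {k : nat}.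
Implicit Type p : 'rV[R]_(2 + k).

Definition xc p : R := p 0 (lshift k 0).
Definition yc p : R := p 0 (lshift k 1).
Definition zc p : 'rV[R]_k := rsubmx p.

Definition enorm (n : nat) (v : 'rV[R]_n) : R :=
  Num.sqrt (\sum_(i < n) v 0 i ^+ 2).

Definition eball (c : 'rV[R]_k) (r : R) : set 'rV[R]_k :=
  [set z | enorm (z - c) < r].

Definition chart (eps : R) (V : set 'rV[R]_k) : set 'rV[R]_(2 + k) :=
  [set p | [/\ 0 <= xc p < eps, 0 <= yc p < eps & V (zc p)]].

Definition chart_interior (eps : R) (B : set 'rV[R]_k) :
    set 'rV[R]_(2 + k) :=
  [set p | [/\ 0 < xc p < eps, 0 < yc p < eps & B (zc p)]].

Definition corner (B : set 'rV[R]_k) : set 'rV[R]_(2 + k) :=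
  [set p | [/\ xc p = 0, yc p = 0 & B (zc p)]].

End Coordinates.

Section Metrics.
Context {R : realType} {N : nat}.
Local Notation pt := 'rV[R]_N.
Local Notation metric := (pt -> 'M[R]_N).

Fixpoint Cn_on (n : nat) (W : set pt) (f : pt -> R) : Prop :=
  match n with
  | 0%N => forall p, W p -> {for p, continuous f}
  | m.+1 => (forall p, W p -> differentiable f p) /\
            (forall v : pt, Cn_on m W (fun p => 'D_v f p))
  end.

(* Smoothness on a set that need not be open (here, a manifold with corners):
   local extendability to a smooth function on an open set. *)
Definition smooth_on (S : set pt) (f : pt -> R) : Prop :=
  forall p, S p -> exists (W : set pt) (h : pt -> R),
    [/\ open W, W p, forall n, Cn_on n W h &
        forall q, W q -> S q -> h q = f q].

Definition qform (A : 'M[R]_N) (v : pt) : R := (v *m A *m v^T) 0 0.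

Definition riemannian_metric (S : set pt) (g : metric) : Prop :=
  [/\ forall i j, smooth_on S (fun p => g p i j),
      forall p, S p -> (g p)^T = g p &
      forall p v, S p -> v != 0 -> 0 < qform (g p) v].

Definition metric_le (S : set pt) (g h : metric) : Prop :=
  forall p v, S p -> qform (g p) v <= qform (h p) v.

Definition euclidean_metric : metric := fun=> 1%:M.

Definition abs_cont_on (a b : R) (f : R -> pt) : Prop :=
  forall e : R, 0 < e -> exists2 d : R, 0 < d &
    forall (n : nat) (s t : 'I_n -> R),
      (forall i, [/\ a <= s i, s i <= t i & t i <= b]) ->
      trivIset setT (fun i => `]s i, t i[%classic) ->
      \sum_(i < n) (t i - s i) < d ->
      \sum_(i < n) `|f (t i) - f (s i)| < e.

(* Absolutely continuous curves in [S] defined on an arbitrary interval [I]: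
   absolute continuity is required on every compact subinterval, hence on [I]
   itself when [I] is compact. *)
Definition ac_curve (I : set R) (S : set pt) (c : R -> pt) : Prop :=
  [/\ is_interval I, forall t, I t -> S (c t) &
      forall a b, a <= b -> `[a, b] `<=` I -> abs_cont_on a b c].

(* An absolutely continuous curve is derivable almost everywhere in [I]; the
   value of [derive1 c] on the remaining null set is irrelevant. *)
Definition curve_length (g : metric) (I : set R) (c : R -> pt) : \bar R :=
  (\int[lebesgue_measure]_(t in I)
    (Num.sqrt (qform (g (c t)) (derive1 c t)))%:E)%E.

Definition length_dist (S : set pt) (g : metric) (p q : pt) : \bar R :=
  ereal_inf [set l | exists (a b : R) (c : R -> pt),
    [/\ a <= b, ac_curve `[a, b]%classic S c, c a = p, c b = q &
        l = curve_length g `[a, b]%classic c]].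

Section Completion.
Variables (S : set pt) (d : pt -> pt -> \bar R).

Definition dist_cauchy (s : nat -> pt) : Prop :=
  (forall n, S (s n)) /\
  forall e : R, 0 < e -> exists n0 : nat, forall m n : nat,
    (n0 <= m)%N -> (n0 <= n)%N -> (d (s m) (s n) < e%:E)%E.

Definition dist_equiv (s s' : nat -> pt) : Prop :=
  d (s n) (s' n) @[n --> \oo] --> 0%E.

(* Points of the metric completion are the equivalence classes of Cauchy
   sequences. *)
Definition completion : set (set (nat -> pt)) :=
  [set C | exists2 s, dist_cauchy s &
    C = [set s' | dist_cauchy s' /\ dist_equiv s s']].

Definition completion_fibre (p : pt) : set (set (nat -> pt)) :=
  [set C | completion C /\ exists2 s, C s & s n @[n --> \oo] --> p].

End Completion.
End Metrics.

Section Exponents.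
Context {R : realType}.
Local Notation RR := (measurableTypeR R * measurableTypeR R)%type.
Implicit Type mu : {finite_measure set RR -> \bar R}.

Definition msupport mu : set (R * R) :=
  [set a | forall O : set (R * R), open O -> O a -> (0 < mu O)%E].

Definition is_maximum (A : set R) (m : R) : Prop := A m /\ ubound A m.

(* [max_exponent mu A] means that the maximum of alpha_1 + alpha_2 over the
   support of [mu] exists and equals [A]. *)
Definition max_exponent mu (A : R) : Prop :=
  is_maximum [set a.1 + a.2 | a in msupport mu] A.

Definition Tmu mu (S : R) : R :=
  \int[mu]_(a in msupport mu) expR (- (S * (2 - a.1 - a.2))).

Definition Fmu (k : nat) mu (u : R * R -> 'rV[R]_(2 + k) -> R)
    (p : 'rV[R]_(2 + k)) : R :=
  \int[mu]_(a in msupport mu) (u a p * xc p `^ (- a.1) * yc p `^ (- a.2)).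

Definition gmu (k : nat) mu (u : R * R -> 'rV[R]_(2 + k) -> R)
    (g0 : 'rV[R]_(2 + k) -> 'M[R]_(2 + k)) (p : 'rV[R]_(2 + k)) :
    'M[R]_(2 + k) :=
  Fmu mu u p *: g0 p.

End Exponents.

Section CornerCurves.
Context {R : realType} {k : nat}.

Definition right_end (I : set R) : set_system R :=
  filter_from I (fun t0 => [set t | I t /\ t0 <= t]).
Definition left_end (I : set R) : set_system R :=
  filter_from I (fun t0 => [set t | I t /\ t <= t0]).

Definition corner_along (F : set_system R) (c : R -> 'rV[R]_(2 + k)) : Prop :=
  (xc (c t) @[t --> F] --> (0 : R)) /\ (yc (c t) @[t --> F] --> (0 : R)).

Definition approaches_corner (eps : R) (B : set 'rV[R]_k) (I : set R)
    (c : R -> 'rV[R]_(2 + k)) : Prop :=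
  ac_curve I (chart_interior eps B) c /\
  (corner_along (right_end I) c \/ corner_along (left_end I) c).

End CornerCurves.

(* Main.v *)
(* With rho = x + y, the conformal factor 1 / (x^2 + y^2) and the lower bound
   c0 gE <= g0 give sqrt (c0 / 2) |d (ln rho)| <= |.|_g.  Hence a curve of
   g-length L changes ln rho by at most sqrt (2 / c0) L, and since ln rho tends
   to -oo at the corner, no curve of finite length and no Cauchy sequence can
   reach it.

   Integrating this bound along an absolutely continuous curve uses the
   fundamental theorem of calculus for absolutely continuous functions: such a
   function is the difference of two nondecreasing absolutely continuous ones
   (through its total variation), each of which has a Lebesgue-Stieltjes measure
   dominated by Lebesgue measure; the Radon-Nikodym density is almost everywhere
   the derivative, by Lebesgue's differentiation theorem. *)

Require Import Defs.
From HB Require Import structures.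
From mathcomp Require Import all_boot all_order all_algebra.
From mathcomp Require Import all_classical all_reals all_analysis.
From mathcomp Require Import measurable_realfun.
From mathcomp Require Import ring lra.

Set Implicit Arguments.
Unset Strict Implicit.
Unset Printing Implicit Defensive.

Import Order.TTheory GRing.Theory Num.Theory.
Import numFieldNormedType.Exports.

Local Open Scope classical_set_scope.
Local Open Scope ring_scope.

(** * Absolutely continuous functions *)

(* Arbitrary finite index types, rather than ['I_n], let a family of intervals
   be refined by partitions through a sum over a sigma type. *)
Definition abs_continuous {R : realType} (a b : R) (f : R -> R) : Prop :=
  forall e : R, 0 < e -> exists2 d : R, 0 < d &
    forall (J : finType) (s t : J -> R),
      (forall i, [/\ a <= s i, s i <= t i & t i <= b]) ->
      trivIset setT (fun i => `]s i, t i[%classic) ->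
      \sum_i (t i - s i) < d -> \sum_i `|f (t i) - f (s i)| < e.

Section AbsoluteContinuity.
Context {R : realType}.
Implicit Types (a b : R) (f : R -> R).

(** A coordinate is dominated by the sup norm of the row vector, so the same [d] serves; enumerating
    [J] turns the family into one indexed by an ordinal. *)
Lemma abs_cont_on_coord (N : nat) a b (c : R -> 'rV[R]_N) (j : 'I_N) :
  abs_cont_on a b c -> abs_continuous a b (fun t => c t 0 j).
Proof.
move=> cac e e0; have [d d0 H] := cac e e0; exists d => // J s t st tr sd.
have sumE (F : J -> R) : \sum_i F i = \sum_(i < #|J|) F (enum_val i).
  exact: (@big_enum_val _ _ _ J xpredT F).
have trE : trivIset setT (fun i : 'I_#|J| => `]s (enum_val i), t (enum_val i)[%classic).
  by move=> i k _ _ /(tr _ _ I I) /enum_val_inj.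
have := H _ (s \o enum_val) (t \o enum_val) (fun i => st (enum_val i)) trE.
rewrite sumE in sd => /(_ sd); apply: le_lt_trans.
rewrite sumE; apply: ler_sum => i _ /=.
rewrite [leRHS]/Num.Def.normr /= mx_normrE.
by apply: le_trans (le_bigmax _ _ (0, j)); rewrite !mxE.
Qed.

Lemma abs_continuousD a b f g : abs_continuous a b f -> abs_continuous a b g ->
  abs_continuous a b (fun x => f x + g x).
Proof.
move=> fac gac e e0; have e20 : 0 < e / 2 by rewrite divr_gt0.
have [d1 d10 H1] := fac _ e20; have [d2 d20 H2] := gac _ e20.
exists (Num.min d1 d2) => [|J s t st tr]; first by rewrite lt_min d10.
rewrite lt_min => /andP[/(H1 J s t st tr) h1 /(H2 J s t st tr) h2].
rewrite [ltRHS]splitr; apply: le_lt_trans (ltrD h1 h2).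
rewrite -big_split /=; apply: ler_sum => i _.
by apply: le_trans (ler_normD _ _); rewrite opprD addrACA.
Qed.

Lemma abs_continuousN a b f : abs_continuous a b f ->
  abs_continuous a b (fun x => - f x).
Proof.
move=> fac e e0; have [d d0 H] := fac e e0; exists d => // J s t st tr sd.
under eq_bigr do rewrite -opprD normrN; exact: H.
Qed.

Lemma abs_continuous_unif_continuous a b f : abs_continuous a b f ->
  forall e, 0 < e -> exists2 d, 0 < d & forall x y,
    a <= x -> x <= y -> y <= b -> y - x < d -> `|f y - f x| < e.
Proof.
move=> fac e e0; have [d d0 H] := fac e e0; exists d => // x y ax xy yb yx.
have := H 'I_1 (fun=> x) (fun=> y); rewrite !big_ord1 /=; apply=> //.
by move=> i j _ _ _; rewrite (ord1 i) (ord1 j).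
Qed.

Lemma abs_continuous_within a b f : a < b -> abs_continuous a b f ->
  {within `[a, b], continuous f}.
Proof.
move=> ab fac; apply/subspace_continuousP => x; rewrite /= in_itv /= => /andP[ax xb].
apply/cvgrPdist_lt => e e0; have [d d0 H] := abs_continuous_unif_continuous fac e0.
rewrite near_withinE; exists d => //= y xyd; rewrite in_itv /= => /andP[ay yb].
have [xy|/ltW yx] := leP x y.
- rewrite distrC; apply: H => //.
  by rewrite (le_lt_trans _ xyd)//= distrC ler_norm.
- by apply: H => //; rewrite (le_lt_trans _ xyd)//= ler_norm.
Qed.

(* [ln] is Lipschitz with constant [1 / m] on [m, +oo[. *)
Lemma abs_continuous_ln a b f m : 0 < m -> (forall x, a <= x <= b -> m <= f x) ->
  abs_continuous a b f -> abs_continuous a b (fun x => ln (f x)).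
Proof.
move=> m0 mf fac e e0; have em0 : 0 < e * m by rewrite mulr_gt0.
have [d d0 H] := fac _ em0; exists d => // J s t st tr sd.
have lnL u v : m <= u -> u <= v -> ln v - ln u <= (v - u) / m.
  move=> mu uv; have u0 := lt_le_trans m0 mu; have v0 := lt_le_trans u0 uv.
  (* With [v / u = 1 + (v - u) / u], the inequality [ln (1 + h) <= h] gives slope [1 / u], which is
     at most [1 / m]. *)
  rewrite -ln_div ?posrE//; apply: (@le_trans _ _ ((v - u) / u)).
    rewrite (_ : v / u = 1 + (v - u) / u); last first.
      by rewrite mulrBl divff ?gt_eqF// addrC subrK.
    by apply: le_ln1Dx; rewrite (lt_le_trans (y := 0)) ?ltrN10// divr_ge0 ?subr_ge0// ltW.
  by rewrite ler_wpM2l ?subr_ge0// lef_pV2 ?posrE.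
have lnA u v : m <= u -> m <= v -> `|ln v - ln u| <= `|v - u| / m.
  move=> mu mv; have [uv|/ltW vu] := leP u v.
  - by rewrite !ger0_norm ?subr_ge0 ?lnL// ler_ln ?posrE// (lt_le_trans m0).
  - rewrite distrC (distrC v) !ger0_norm ?subr_ge0 ?lnL//.
    by rewrite ler_ln ?posrE// (lt_le_trans m0).
apply: (@le_lt_trans _ _ (\sum_i `|f (t i) - f (s i)| / m)).
  apply: ler_sum => i _; have [as_ st_ tb] := st i.
  by apply: lnA; apply: mf; rewrite ?as_ ?tb ?(le_trans st_) ?(le_trans as_).
by rewrite -mulr_suml ltr_pdivrMr//; exact: H.
Qed.

(** Cutting each interval of a disjoint family along its partition yields a disjoint family of the
    same total length, whose increments sum to the variations. The [d] of absolute continuity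
    therefore works unchanged. *)
Lemma abs_continuous_variations a b f e : a <= b -> abs_continuous a b f -> 0 < e ->
  exists2 d : R, 0 < d & forall (J : finType) (s t : J -> R) (l : J -> seq R),
    (forall i, [/\ a <= s i, s i <= t i & t i <= b]) ->
    trivIset setT (fun i => `]s i, t i[%classic) ->
    (forall i, itv_partition (s i) (t i) (l i)) ->
    \sum_i (t i - s i) < d -> \sum_i variation (s i) (t i) f (l i) < e.
Proof.
move=> ab fac e0; have [d d0 H] := fac e e0; exists d => // J s t l st tr lP sd.
(* Partition points of the [i]-th interval, from [x i 0 = s i] to [x i (size (l i)) = t i]. *)
pose x i n := nth (t i) (s i :: l i) n.
have xS i n : (n < size (l i))%N -> x i n <= x i n.+1.
  exact: (nondecreasing_fun_itv_partition (f := id) (fun u v _ _ uv => uv) (lP i)).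
have xmono i n m : (n <= m <= size (l i))%N -> x i n <= x i m.
  move=> /andP[]; elim: m => [|m IH]; first by rewrite leqn0 => /eqP->.
  rewrite leq_eqVlt => /orP[/eqP->//|]; rewrite ltnS => nm ml.
  by rewrite (le_trans (IH nm (ltnW ml)))// xS.
have xl i : x i (size (l i)) = t i by rewrite /x (itv_partition_nth_size _ (lP i)).
have := H {i : J & 'I_(size (l i))} (fun p => x (tag p) (tagged p))
  (fun p => x (tag p) (tagged p).+1).
rewrite -(@sig_big_dep _ _ _ J (fun i => 'I_(size (l i))) xpredT (fun=> xpredT)
  (fun i k => `|f (x i k.+1) - f (x i k)|)) /=.
rewrite -(@sig_big_dep _ _ _ J (fun i => 'I_(size (l i))) xpredT (fun=> xpredT)
  (fun i k => x i k.+1 - x i k)) /=.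
have -> : \sum_i \sum_(k < size (l i)) (x i k.+1 - x i k) = \sum_i (t i - s i).
  apply: eq_bigr => i _; rewrite -(big_mkord xpredT (fun k => x i k.+1 - x i k)).
  by rewrite telescope_sumr// xl.
have -> : \sum_i \sum_(k < size (l i)) `|f (x i k.+1) - f (x i k)| =
    \sum_i variation (s i) (t i) f (l i).
  apply: eq_bigr => i _.
  by rewrite -(big_mkord xpredT (fun k => `|f (x i k.+1) - f (x i k)|)).
apply=> //.
- move=> [i [k kl]] /=; have [as_ _ tb] := st i; split.
  + by rewrite (le_trans as_)// -[s i]/(x i 0%N) xmono//= ltnW.
  + exact: xS.
  + by rewrite (le_trans _ tb)// -xl xmono// kl/=.
- move=> [i k] [i' k'] _ _ [y [/=]]; rewrite !in_itv /= => /andP[y1 y2] /andP[y3 y4].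
  (* Cells that meet lie in intervals of the original family that meet, hence in the same one;
     monotonicity of [x i] then forces the same cell. *)
  have ii' : i = i'.
    apply: (tr i i' I I); exists y; split; rewrite /= in_itv /=; apply/andP; split.
    + by apply: le_lt_trans y1; rewrite -[s i]/(x i 0%N) xmono//= ltnW.
    + by apply: (lt_le_trans y2); rewrite -xl xmono// ltn_ord/=.
    + by apply: le_lt_trans y3; rewrite -[s i']/(x i' 0%N) xmono//= ltnW.
    + by apply: (lt_le_trans y4); rewrite -xl xmono// ltn_ord/=.
  case: i' / ii' k' y3 y4 => k' y3 y4; congr existT; apply/val_inj => /=.
  have [kk'|kk'|//] := ltngtP k k'.
  + have := lt_trans y3 y2; rewrite ltNge xmono//; apply/andP; split=> //; exact: ltnW.
  + have := lt_trans y1 y4; rewrite ltNge xmono//; apply/andP; split=> //; exact: ltnW.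
Qed.

(** Taking [e = 1], the variation is at most 1 on any interval shorter than [d], and finitely many
    steps of length [d / 2] lead from [a] to [b]. *)
Lemma abs_continuous_bounded_variation a b f : a < b -> abs_continuous a b f ->
  bounded_variation a b f.
Proof.
move=> ab fac; have [d d0 H] := abs_continuous_variations (ltW ab) fac ltr01.
have small x y : a <= x -> x <= y -> y <= b -> y - x < d -> bounded_variation x y f.
  move=> ax xy yb yx; exists 1 => _ [l lxy <-].
  have := H 'I_1 (fun=> x) (fun=> y) (fun=> l); rewrite !big_ord1 /= => h.
  by apply/ltW/h => // i j _ _ _; rewrite (ord1 i) (ord1 j).
have step n : bounded_variation a (Num.min b (a + n%:R * (d / 2))) f.
  elim: n => [|n IH].
    by rewrite mul0r addr0 min_r ?(ltW ab)//; exact: bounded_variationxx.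
  set x := Num.min b _ in IH; set y := Num.min _ _.
  have d20 : 0 <= d / 2 by rewrite divr_ge0// ltW.
  have ax : a <= x by rewrite le_min (ltW ab) lerDl mulr_ge0.
  have yb : y <= b by rewrite ge_min lexx.
  have xy : x <= y.
    by rewrite le_min !ge_min lexx lerD2l ler_wpM2r ?ler_nat ?orbT.
  have yx : y - x < d.
    rewrite ltrBlDr; apply: (@le_lt_trans _ _ (d / 2 + x)); last first.
      by rewrite ltrD2r gtr_pMr// invf_lt1 ?ltr1n.
    have [bx|xb] := leP b (a + n%:R * (d / 2)).
      by rewrite /x min_l// (le_trans yb)// lerDr.
    rewrite /x min_r ?(ltW xb)// addrCA ge_min; apply/orP; right.
    by rewrite lerD2l -natr1 mulrDl mul1r addrC.
  apply/bounded_variationP; first exact: le_trans xy.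
  rewrite (total_variationD _ ax xy) fin_numD.
  by apply/andP; split; apply/bounded_variationP => //; exact: small.
have [n bn] : exists n : nat, b <= a + n%:R * (d / 2).
  exists (Num.truncn ((b - a) / (d / 2))).+1.
  rewrite -lerBlDl -ler_pdivrMr ?divr_gt0//; apply/ltW.
  by rewrite truncnS_gt.
by have := step n; rewrite min_l.
Qed.

(** On each interval a partition realises the total variation up to an error [r]. The partition
    variations sum to less than [e / 2], and so do the errors up to equality. *)
Lemma abs_continuous_total_variation a b f : a < b -> abs_continuous a b f ->
  abs_continuous a b (fun x => fine (total_variation a x f)).
Proof.
move=> ab fac e e0; have e20 : 0 < e / 2 by rewrite divr_gt0.
have [d d0 H] := abs_continuous_variations (ltW ab) fac e20.
have fbv := abs_continuous_bounded_variation ab fac.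
exists d => // J s t st tr sd.
have tvfin x y : a <= x -> x <= y -> y <= b -> total_variation x y f \is a fin_num.
  move=> ax xy yb; apply/bounded_variationP => //.
  exact: bounded_variationl xy yb (bounded_variationr ax (le_trans xy yb) fbv).
(* The successor keeps the divisor positive when [J] is empty. *)
pose r := e / 2 / #|J|.+1%:R.
have r0 : 0 < r by rewrite divr_gt0.
have [l lP] : exists l : J -> seq R, forall i, itv_partition (s i) (t i) (l i) /\
    fine (total_variation (s i) (t i) f) < variation (s i) (t i) f (l i) + r.
  suff /choice[l lP] : forall i, exists l, itv_partition (s i) (t i) l /\
      fine (total_variation (s i) (t i) f) < variation (s i) (t i) f l + r.
    by exists l.
  move=> i; have [as_ st_ tb] := st i.
  have tvf := tvfin _ _ as_ st_ tb.
  have [_ [_ [l lst <-] <-] lr] := ub_ereal_sup_adherent r0 tvf.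
  exists l; split=> //; move: lr; rewrite -/(total_variation _ _ _).
  by rewrite -{1}(fineK tvf) -EFinB lte_fin ltrBlDr.
have := H J s t l st tr (fun i => (lP i).1) sd => Hl.
rewrite [ltRHS]splitr.
apply: (@le_lt_trans _ _ (\sum_i (variation (s i) (t i) f (l i) + r))).
  apply: ler_sum => i _; have [as_ st_ tb] := st i.
  rewrite (total_variationD f as_ st_) fineD ?tvfin//; last exact: le_trans tb.
  rewrite addrAC subrr add0r ger0_norm ?fine_ge0 ?total_variation_ge0//.
  by apply/ltW; have [] := lP i.
rewrite big_split /= ltr_leD// sumr_const -[leLHS]mulr_natr /r.
by rewrite mulrAC ler_pdivrMr// ler_wpM2l ?ler_nat// ltW.
Qed.

End AbsoluteContinuity.

(** * Lebesgue-Stieltjes measures *)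

Section LebesgueStieltjes.
Context {R : realType}.
Local Notation mu := (@lebesgue_measure R).

Lemma lebesgue_stieltjes_itv_oc (F : cumulative R R) (x y : R) : x <= y ->
  lebesgue_stieltjes_measure F `]x, y]%classic = (F y - F x)%:E.
Proof.
move=> xy; rewrite /lebesgue_stieltjes_measure /measure_extension.
by rewrite measurable_mu_extE/=; [rewrite wlength_itv_bnd|exact: is_ocitv].
Qed.

Lemma lebesgue_stieltjes_set1 (F : cumulative R R) (x : R) :
  {for x, continuous F} -> lebesgue_stieltjes_measure F [set x] = 0%E.
Proof.
move=> Fx; apply/eqP; rewrite eq_le measure_ge0 andbT.
apply/lee_addgt0Pr => e e0; rewrite add0e.
have /cvgrPdist_lt/(_ _ e0)[d /= d0 H] := Fx.
apply: (@le_trans _ _ (lebesgue_stieltjes_measure F `]x - d / 2, x]%classic)).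
  apply: le_measure; rewrite ?inE//=.
  by move=> _ -> /=; rewrite in_itv/= lexx ltrBlDr ltrDl divr_gt0.
have xd : x - d / 2 <= x by rewrite lerBlDr lerDl divr_ge0// ltW.
rewrite lebesgue_stieltjes_itv_oc// lee_fin (le_trans (ler_norm _))// ltW// H//=.
rewrite opprB addrC subrK ger0_norm ?divr_ge0// ?ltW//.
by rewrite gtr_pMr// invf_lt1 ?ltr1n.
Qed.

Lemma lebesgue_stieltjes_itv_cc (F : cumulative R R) (x y : R) : x <= y ->
  {for x, continuous F} ->
  lebesgue_stieltjes_measure F `[x, y]%classic = (F y - F x)%:E.
Proof.
move=> xy Fx; rewrite -(setU1itv false) ?bnd_simp//= measureU//=.
- by rewrite lebesgue_stieltjes_set1// add0e lebesgue_stieltjes_itv_oc.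
- by apply/seteqP; split=> // z [/= ->]; rewrite in_itv/= ltxx.
Qed.

(** The endpoints are the infimum and supremum of [A], or the degenerate pair [a, a] when [A] is
    empty. *)
Lemma interval_between (a b : R) (A : set R) : a <= b -> is_interval A ->
  A `<=` `[a, b] -> exists s t, [/\ a <= s, s <= t, t <= b,
    `]s, t[ `<=` A & A `<=` `[s, t]].
Proof.
move=> ab iA Aab; have [->|/set0P[x Ax]] := eqVneq A set0.
  by exists a, a; split=> //; rewrite set_itvoo0.
have ubA : ubound A b by move=> z /Aab /=; rewrite in_itv /= => /andP[].
have lbA : lbound A a by move=> z /Aab /=; rewrite in_itv /= => /andP[].
have hs : has_sup A by split; [exists x|exists b].
have hi : has_inf A by split; [exists x|exists a].
exists (inf A), (sup A); split.
- by apply: lb_le_inf => //; exists x.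
- apply: (@le_trans _ _ x); first exact: ge_inf hi.2 _ Ax.
  exact: ub_le_sup hs.2 _ Ax.
- by apply: ge_sup => //; exists x.
- move=> z; rewrite /= in_itv /= => /andP[iz zs].
  have [u Au uz] := inf_lt hi.1 iz.
  have [v Av zv] := sup_gt hs.1 zs.
  by apply: (iA u v) => //; rewrite !ltW.
- move=> z Az; rewrite /= in_itv /=; apply/andP; split.
  + exact: ge_inf hi.2 _ Az.
  + exact: ub_le_sup hs.2 _ Az.
Qed.

(** A null set has an open neighbourhood of Lebesgue measure below [d]. Its components inside []a,
    b[] are disjoint intervals of total length below [d], so their [F]-increments, which are their
    Stieltjes measures, sum to at most [e]. *)
Lemma lebesgue_stieltjes_abs_continuous (F : cumulative R R) (a b : R) (N : set R) :
  a <= b -> continuous F -> abs_continuous a b F ->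
  measurable N -> mu N = 0%E ->
  lebesgue_stieltjes_measure F (N `&` `]a, b]) = 0%E.
Proof.
move=> ab cF acF mN N0.
pose nu : {measure set (measurableTypeR R) -> \bar R} := lebesgue_stieltjes_measure F.
have nu1 x : nu [set x] = 0%E by exact: lebesgue_stieltjes_set1 (cF x).
have nucc x y : x <= y -> nu `[x, y]%classic = (F y - F x)%:E.
  by move=> xy; exact: lebesgue_stieltjes_itv_cc xy (cF x).
rewrite -[LHS]/(nu (N `&` `]a, b])).
have mNab : measurable (N `&` `]a, b[) by exact: measurableI.
(* The endpoint [b] carries no mass because [F] is continuous. *)
suff N0' : nu (N `&` `]a, b[) = 0%E.
  apply/eqP; rewrite eq_le measure_ge0 andbT.
  apply: (@le_trans _ _ (nu ((N `&` `]a, b[) `|` [set b]))).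
    apply: le_measure; rewrite ?inE; [exact: measurableI|exact: measurableU|].
    move=> z [Nz]; rewrite /= in_itv /= => /andP[az]; rewrite le_eqVlt.
    by move=> /predU1P[->|zb]; [right|left; split=> //=; rewrite in_itv/= az].
  have E : nu ((N `&` `]a, b[) `|` [set b]) = 0%E.
    by have -> := @measureU0 _ _ _ nu _ _ mNab (measurable_set1 b) (nu1 b).
  by rewrite E.
apply/eqP; rewrite eq_le measure_ge0 andbT.
apply/lee_addgt0Pr => e e0; rewrite add0e.
have [d d0 H] := acF e e0.
have Noo : (mu N < +oo)%E by rewrite N0.
have [U [oU NU UN]] := lebesgue_regularity_outer mN Noo d0.
have muU : (mu U < d%:E)%E.
  have mUN : measurable (U `\` N) by apply: measurableD => //; exact: open_measurable.
  have -> : U = N `|` (U `\` N) by rewrite setDUK.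
  by have := @measureU2 _ _ _ mu _ _ mN mUN; rewrite /= N0 add0e => /le_lt_trans; exact.
pose A n := open_disjoint_itv oU n `&` `]a, b[.
have mA n : measurable (A n).
  by apply: measurableI => //; apply: open_measurable; apply: open_disjoint_itv_open.
have tA : trivIset setT A.
  move=> i j _ _ [z [[Ii _] [Ij _]]].
  by apply: (@open_disjoint_itv_trivIset _ _ oU i j I I); exists z.
(* The inner open intervals inherit disjointness and the Lebesgue bound from [A n]; the outer closed
   ones bound [nu (A n)] by an increment of [F]. *)
have /choice[s /choice[t st]] : forall n, exists s t,
    [/\ a <= s, s <= t, t <= b, `]s, t[ `<=` A n & A n `<=` `[s, t]].
  move=> n.
  apply: interval_between => //.
    move=> x y [Ix xab] [Iy yab] z xyz; split.
      exact: (open_disjoint_itv_is_interval Ix Iy).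
    exact: (interval_is_interval xab yab).
  by move=> z [_]; exact: subset_itv_oo_cc.
have tst : trivIset setT (fun n => `]s n, t n[%classic).
  move=> i j _ _ [z [zi zj]]; have [_ _ _ si _] := st i; have [_ _ _ sj _] := st j.
  by apply: (tA i j I I); exists z; split; [exact: si|exact: sj].
have muE i : mu `]s i, t i[%classic = (t i - s i)%:E.
  rewrite lebesgue_measure_itv /= lte_fin.
  have [_ + _ _ _] := st i; rewrite le_eqVlt => /predU1P[->|->//].
  by rewrite ltxx subrr.
(* Absolute continuity concerns finite families, so each partial sum is bounded; the bound passes to
   the series for [nu] in the limit. *)
have sumF n : \sum_(i < n) (F (t i) - F (s i)) < e.
  have := H 'I_n (fun i => s i) (fun i => t i) => h.
  apply: le_lt_trans (h _ _ _).
  - by apply: ler_sum => i _; exact: ler_norm.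
  - by move=> i; have [] := st i.
  - by move=> i j _ _ /(tst _ _ I I)/val_inj.
  - rewrite -lte_fin; apply: le_lt_trans muU; rewrite -sumEFin.
    apply: (@le_trans _ _ (mu (\big[setU/set0]_(i < n) `]s i, t i[%classic))).
      have -> := @measure_semi_additive_ord_I _ _ _ mu (fun i => `]s i, t i[%classic) n.
      - by apply: lee_sum => i _; rewrite -[leLHS]muE; exact: lexx.
      - by move=> i _; exact: measurable_itv.
      - exact: sub_trivIset tst.
      - by apply: bigsetU_measurable => i _; exact: measurable_itv.
    apply: le_measure; rewrite ?inE; [exact: bigsetU_measurable|exact: open_measurable|].
    rewrite -(bigcup_mkord n (fun i => `]s i, t i[%classic)) => z [i _].
    have [_ _ _ si _] := st i => /si [Iz _].
    by rewrite (open_disjoint_itv_bigcup oU); exists i.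
apply: (@le_trans _ _ (nu (\bigcup_n A n))).
  apply: le_measure; rewrite ?inE//; first by apply: bigcup_measurable => k _; exact: mA.
  rewrite /A -setI_bigcupl -open_disjoint_itv_bigcup; exact: setSI.
rewrite measure_semi_bigcup//; last by apply: bigcup_measurable => k _; exact: mA.
apply: lime_le; first by apply: is_cvg_ereal_nneg_natsum => n _; exact: measure_ge0.
apply: nearW => n; rewrite big_mkord.
apply: (@le_trans _ _ (\sum_(i < n) (F (t i) - F (s i)))%:E).
  rewrite -sumEFin; apply: lee_sum => i _; have [_ sti _ _ Ai] := st i.
  rewrite -nucc//; apply: le_measure; rewrite ?inE.
  - exact: mA.
  - exact: measurable_itv.
  - exact: Ai.
by rewrite lee_fin ltW.
Qed.

End LebesgueStieltjes.

(** * The fundamental theorem of calculus *)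

Section AbsContinuousFTC.
Context {R : realType}.
Local Notation mu := (@lebesgue_measure R).

(** The density is the Radon-Nikodym derivative of the Stieltjes measure of [F], restricted to []a,
    b]] so as to be finite. *)
Lemma nondecreasing_abs_continuous_density (a b : R) (F : R -> R) : a < b ->
  {in `[a, b] &, nondecreasing_fun F} -> abs_continuous a b F ->
  exists2 g : R -> R, mu.-integrable setT (EFin \o g) &
    forall x, a <= x <= b -> F x - F a = \int[mu]_(t in `]a, x]) g t.
Proof.
move=> ab ndF acF.
(* Clamping to [[a, b]] is monotone and 1-Lipschitz, so [F \o cl] extends [F] to a continuous
   nondecreasing function on the whole line. *)
pose cl x := Num.max a (Num.min x b).
have clE x : a <= x <= b -> cl x = x.
  by move=> /andP[ax xb]; rewrite /cl min_l// max_r.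
have cla x : a <= cl x by rewrite le_max lexx.
have clb x : cl x <= b by rewrite ge_max (ltW ab) ge_min lexx orbT.
have clI x : cl x \in `[a, b] by rewrite in_itv /= cla clb.
have clnd x y : x <= y -> cl x <= cl y.
  move=> xy; rewrite /cl ge_max le_max lexx /= le_max; apply/orP; right.
  by rewrite le_min !ge_min xy lexx /= orbT.
have cl1 x y : x <= y -> cl y - cl x <= y - x.
  move=> xy; rewrite lerBlDr {1}/cl ge_max; apply/andP; split.
    by rewrite (le_trans (cla x))// lerDr subr_ge0.
  apply: (@le_trans _ _ (y - x + Num.min x b)); last by rewrite lerD2l le_max lexx orbT.
  have [xb|bx] := leP x b; first by rewrite subrK ge_min lexx.
  by rewrite ge_min lerDr subr_ge0 xy orbT.
pose Fe x := F (cl x).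
have Fend : nondecreasing Fe by move=> x y xy; apply: ndF; rewrite ?clI ?clnd.
have Fec : continuous Fe.
  move=> x; apply/cvgrPdist_lt => e e0.
  have [d d0 H] := abs_continuous_unif_continuous acF e0.
  exists d => //= y xyd; have [xy|/ltW yx] := leP x y.
  - rewrite distrC; apply: H; rewrite ?clnd// (le_lt_trans (cl1 _ _ xy))//.
    by rewrite (le_lt_trans _ xyd)//= distrC ler_norm.
  - apply: H; rewrite ?clnd// (le_lt_trans (cl1 _ _ yx))//.
    by rewrite (le_lt_trans _ xyd)//= ler_norm.
pose Fc : cumulative R R :=
  HB.pack Fe (isCumulative.Build R _ R Fe Fend (right_continuousW Fec)).
have acFc : abs_continuous a b Fc.
  move=> e e0; have [d d0 H] := acF e e0; exists d => // J s t st tr sd.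
  have := H J s t st tr sd; apply: le_lt_trans; apply: ler_sum => i _.
  have [as_ st_ tb] := st i.
  by rewrite /= /Fe !clE// ?as_ ?tb ?(le_trans st_) ?(le_trans as_).
pose nu : {measure set (measurableTypeR R) -> \bar R} := lebesgue_stieltjes_measure Fc.
pose D : set (measurableTypeR R) := `]a, b]%classic.
have mD : measurable D by exact: measurable_itv.
have nuitv x y : x <= y -> nu `]x, y]%classic = (Fe y - Fe x)%:E.
  by move=> xy; exact: (@lebesgue_stieltjes_itv_oc _ Fc).
have nuDoo : (nu D < +oo)%E by rewrite nuitv ?ltW// ltry.
pose nuD : {finite_measure set (measurableTypeR R) -> \bar R} := mfrestr mD nuDoo.
have nuDmu : nuD `<< (mu : {measure set (measurableTypeR R) -> \bar R}).
  apply/null_content_dominatesP => N mN N0.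
  by apply: (@lebesgue_stieltjes_abs_continuous _ Fc); rewrite ?ltW.
have [f [f0 ffin fint fE]] := radon_nikodym_sigma_finite nuDmu.
have fineE : EFin \o (fine \o f) = f by apply/funext => x /=; rewrite fineK.
exists (fine \o f); first by rewrite fineE.
move=> x /andP[ax xb]; rewrite /Rintegral.
have mx : measurable (`]a, x]%classic : set (measurableTypeR R)) by exact: measurable_itv.
have := fE _ mx.
under [X in _ -> _ = fine X]eq_integral do rewrite fineK//.
move=> <-; rewrite /nuD /= /mfrestr /mrestr setIidl; last first.
  by apply: subset_itvl; rewrite bnd_simp.
rewrite -[lebesgue_stieltjes_measure _ _]/(nu `]a, x]%classic) nuitv//=.
by rewrite /Fe !clE ?lexx ?ax// ltW.
Qed.

(** Jordan decomposition [f = T - (T - f)] with [T] the total variation from [a]: increments of [f]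
    never exceed those of [T], so both terms are nondecreasing and absolutely continuous. *)
Lemma abs_continuous_density (a b : R) (f : R -> R) : a < b ->
  abs_continuous a b f ->
  exists2 g : R -> R, mu.-integrable setT (EFin \o g) &
    forall x, a <= x <= b -> f x - f a = \int[mu]_(t in `]a, x]) g t.
Proof.
move=> ab acf; have bvf := abs_continuous_bounded_variation ab acf.
pose T x := fine (total_variation a x f).
have acT : abs_continuous a b T by exact: abs_continuous_total_variation.
have Tfin x : a <= x <= b -> total_variation a x f \is a fin_num.
  move=> /andP[ax xb]; apply/bounded_variationP => //.
  exact: bounded_variationl xb bvf.
have TD x y : x \in `[a, b] -> y \in `[a, b] -> x <= y ->
    f y - f x <= T y - T x /\ 0 <= T y - T x.
  rewrite !in_itv /= => xab yab xy; have /andP[ax xb] := xab.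
  rewrite /T (total_variationD f ax xy) fineD ?Tfin//; last first.
    have := Tfin _ yab; rewrite (total_variationD f ax xy) fin_numD.
    by case/andP.
  rewrite addrAC subrr add0r fine_ge0 ?total_variation_ge0//; split=> //.
  have := total_variation_ge f xy; have := Tfin _ yab.
  rewrite (total_variationD f ax xy) fin_numD => /andP[_ xyf].
  by rewrite -{1}(fineK xyf) lee_fin; apply: le_trans; exact: ler_norm.
have ndT : {in `[a, b] &, nondecreasing_fun T}.
  by move=> x y xab yab xy; have [_] := TD x y xab yab xy; rewrite subr_ge0.
have ndTf : {in `[a, b] &, nondecreasing_fun (fun x => T x - f x)}.
  by move=> x y xab yab xy; have [+ _] := TD x y xab yab xy; lra.
have acTf : abs_continuous a b (fun x => T x - f x).
  by apply: abs_continuousD => //; exact: abs_continuousN.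
have [g gi gE] := nondecreasing_abs_continuous_density ab ndT acT.
have [h hi hE] := nondecreasing_abs_continuous_density ab ndTf acTf.
exists (fun x => g x - h x).
  have -> : EFin \o (fun x => g x - h x) = ((EFin \o g) \- (EFin \o h))%E.
    by apply/funext => x /=; rewrite EFinB.
  exact: integrableB.
move=> x xab.
have mx : measurable (`]a, x]%classic : set (measurableTypeR R)) by exact: measurable_itv.
rewrite RintegralB//.
- by rewrite -gE// -hE//; lra.
- exact: integrableS gi.
- exact: integrableS hi.
Qed.

Lemma abs_continuous_FTC (a b : R) (f : R -> R) : a < b ->
  abs_continuous a b f ->
  exists g : R -> R, [/\ mu.-integrable setT (EFin \o g),
    f b - f a = \int[mu]_(t in `]a, b]) g t &
    {ae mu, forall t, t \in `]a, b[ -> derivable f t 1 /\ derive1 f t = g t}].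
Proof.
move=> ab acf; have [g gi gE] := abs_continuous_density ab acf.
exists g; split=> //; first by apply: gE; rewrite lexx ltW.
have gy y : mu.-integrable (`]a, y]%classic : set (measurableTypeR R)) (EFin \o g).
  by apply: integrableS gi => //; exact: measurable_itv.
have gloc : locally_integrable [set: R] g.
  by apply: open_integrable_locally gi; exact: openT.
have := FTC1 gy gloc.
apply: filterS; first exact: (ae_filter_ringOfSetsType mu).
move=> t ht; rewrite in_itv /= => /andP[at_ tb].
have [] := ht at_; set G := (fun x => _) => dG GE.
(* The integral formula for [f] holds only on [[a, b]], so the derivative of [G] is transferred at
   interior points, by local equality. *)
have nearE : \forall x \near t, (cst (f a) + G) x = f x.
  near=> x; have xab : a <= x <= b.
    apply/andP; split; apply/ltW.
    - by near: x; exact: lt_nbhsr.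
    - by near: x; exact: lt_nbhsl.
  by rewrite /= fctE /G -(gE x xab) addrC subrK.
have GD : is_derive t (1:R) G (g t).
  by apply: DeriveDef dG _; rewrite -derive1E GE.
have [df fE] := near_eq_is_derive nearE (is_deriveD (is_derive_cst (f a) t 1) GD).
by split=> //; rewrite derive1E fE add0r.
Unshelve. all: by end_near. Qed.

End AbsContinuousFTC.

(** * Lengths of curves *)

Section CurveLength.
Context {R : realType}.
Local Notation mu := (@lebesgue_measure R).

(* No measurability is needed: the integral of a nonnegative function is
   defined as a supremum over the simple functions below it. *)
Lemma ge0_le_integral_subset d (T : measurableType d) (m : {measure set T -> \bar R})
    (D1 D2 : set T) (f1 f2 : T -> \bar R) : D1 `<=` D2 ->
  (forall x, D1 x -> (0 <= f1 x)%E) -> (forall x, D2 x -> (0 <= f2 x)%E) ->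
  (forall x, D1 x -> (f1 x <= f2 x)%E) ->
  (\int[m]_(x in D1) f1 x <= \int[m]_(x in D2) f2 x)%E.
Proof.
move=> D12 f10 f20 f12; rewrite (integral_mkcond D1) (integral_mkcond D2).
have h10 x : (0 <= (f1 \_ D1) x)%E by apply: erestrict_ge0.
have h20 x : (0 <= (f2 \_ D2) x)%E by apply: erestrict_ge0.
rewrite !ge0_integralTE//; apply: le_ereal_sup => _ [h hf <-].
exists h => // x; apply: (le_trans (hf x)).
rewrite !patchE; case: ifPn => [/set_mem D1x|_].
  by rewrite mem_set ?f12//; exact: D12.
by case: ifPn => // /set_mem /f20.
Qed.

Lemma derive1_coord (N : nat) (c : R -> 'rV[R]_N) (t : R) (j : 'I_N) :
  derivable c t 1 -> derive1 (fun s => c s 0 j) t = derive1 c t 0 j.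
Proof. by move=> ct; rewrite !derive1E derive_mx// mxE. Qed.

Lemma curve_length_ge0 (N : nat) (g : 'rV[R]_N -> 'M[R]_N) (I : set R) c :
  (0 <= curve_length g I c)%E.
Proof. by apply: integral_ge0 => t _; rewrite lee_fin sqrtr_ge0. Qed.

Lemma curve_length_subset (N : nat) (g : 'rV[R]_N -> 'M[R]_N) (I J : set R) c :
  I `<=` J -> (curve_length g I c <= curve_length g J c)%E.
Proof.
by move=> IJ; apply: ge0_le_integral_subset => // t _; rewrite lee_fin sqrtr_ge0.
Qed.

(** The speed dominates [sqrt (c0 / 2)] times the derivative of [ln (x + y)], since
    [(x' + y')^2 <= 2 (x'^2 + y'^2)] and, for positive coordinates, [x^2 + y^2 <= (x + y)^2]. The
    bound is then integrated along the curve. *)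
Lemma ln_coord_sum_le_curve_length (k : nat) (S : set 'rV[R]_(2 + k))
    (g : 'rV[R]_(2 + k) -> 'M[R]_(2 + k)) (c0 a b : R) (c : R -> 'rV[R]_(2 + k)) :
  0 <= c0 -> a <= b -> (forall p, S p -> 0 < xc p /\ 0 < yc p) ->
  (forall p (v : 'rV[R]_(2 + k)), S p ->
    c0 * (\sum_i v 0 i ^+ 2) / (xc p ^+ 2 + yc p ^+ 2) <= qform (g p) v) ->
  ac_curve `[a, b]%classic S c ->
  ((Num.sqrt (c0 / 2) *
     `|ln (xc (c b) + yc (c b)) - ln (xc (c a) + yc (c a))|)%:E
   <= curve_length g `[a, b]%classic c)%E.
Proof.
move=> c00; rewrite le_eqVlt => /predU1P[-> _ _ _|ab S0 gS [_ Sc acc]].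
  by rewrite subrr normr0 mulr0 curve_length_ge0.
have {}acc := acc a b (ltW ab) (@subset_refl _ _).
pose s t := xc (c t) + yc (c t); pose phi t := ln (s t).
have s0 t : t \in `[a, b] -> 0 < s t.
  by move=> /Sc /S0[x0 y0]; rewrite /s addr_gt0.
have acs : abs_continuous a b s by apply: abs_continuousD; exact: abs_cont_on_coord.
(* The minimum of [s] on the compact interval is positive, which keeps [ln] Lipschitz on the values
   of [s]. *)
have [m mab sm] := EVT_min (ltW ab) (abs_continuous_within ab acs).
have acphi : abs_continuous a b phi by apply: abs_continuous_ln (s0 _ mab) sm acs.
have [psi [psii psiE psiD]] := abs_continuous_FTC ab acphi.
(* Applying the fundamental theorem to each of the finitely many coordinates makes the curve
   derivable almost everywhere, so that [derive1 c] is the true velocity there. *)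
have : {ae mu, forall t, forall j : 'I_(2 + k), t \in `]a, b[ ->
    derivable (fun t => c t 0 j) t 1}.
  apply: (@filter_forall _ _
    (fun j t => t \in `]a, b[ -> derivable (fun t => c t 0 j) t 1)).
    exact: (ae_filter_ringOfSetsType mu).
  move=> j; have [gj [_ _]] := abs_continuous_FTC ab (abs_cont_on_coord j acc).
  apply: filterS; first exact: (ae_filter_ringOfSetsType mu).
  by move=> t + tab => /(_ tab)[].
move=> /(@filterI _ _ (ae_filter_ringOfSetsType mu) _ _ psiD)[N [mN N0 NP]].
pose K := Num.sqrt (c0 / 2); pose D : set (measurableTypeR R) := `]a, b]%classic.
(* The density is integrated over []a, b]] but identified with the derivative only on []a, b[], so
   [b] joins the exceptional set. *)
pose N' : set (measurableTypeR R) := N `|` [set b].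
have mb : measurable ([set b] : set (measurableTypeR R)) by exact: measurable_set1.
have mN' : measurable N' by exact: measurableU.
have mD : measurable D by exact: measurable_itv.
have N'0 : mu N' = 0%E.
  have b0 : mu [set b] = 0%E by exact: lebesgue_measure_set1.
  by have -> := @measureU0 _ _ _ mu _ _ mN mb b0.
have psiiD : mu.-integrable D (EFin \o psi) by exact: integrableS psii.
have mpsi : measurable_fun D (fun t => `|psi t|%:E).
  have := measurable_int _ psiiD => /measurable_EFinP mp.
  by apply/measurable_EFinP; exact: measurableT_comp.
(* The exceptional set is removed on the side of [psi], whose measurability is known; the comparison
   with the speed is then pointwise. *)
have KE : (K%:E * \int[mu]_(t in D) `|psi t|%:E =
    \int[mu]_(t in D `\` N') (K%:E * `|psi t|%:E))%E.
  rewrite -ge0_integralZl_EFin//; last exact: sqrtr_ge0.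
  apply: ge0_negligible_integral => //.
  - exact: measurable_funeM.
  - by move=> t _; rewrite -EFinM lee_fin mulr_ge0// sqrtr_ge0.
rewrite EFinM -/(s b) -/(s a) -/(phi b) -/(phi a) psiE.
apply: (@le_trans _ _ (K%:E * \int[mu]_(t in D) `|psi t|%:E)%E).
  rewrite lee_wpmul2l ?lee_fin ?sqrtr_ge0//.
  by rewrite EFin_normr_Rintegral// le_abse_integral//; exact: measurable_int psiiD.
rewrite KE; apply: ge0_le_integral_subset.
- by move=> t [+ _]; exact: subset_itv_oc_cc.
- by move=> t _; rewrite -EFinM lee_fin mulr_ge0// sqrtr_ge0.
- by move=> t _; rewrite lee_fin sqrtr_ge0.
move=> t [Dt N't].
have tab : t \in `]a, b[.
  move: Dt; rewrite /D /= !in_itv /= => /andP[-> tb]; rewrite lt_neqAle tb andbT.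
  by apply/eqP => tb'; apply: N't; right.
have [/(_ tab)[dphi phiE] dc] :
    (t \in `]a, b[ -> derivable phi t 1 /\ derive1 phi t = psi t) /\
    (forall j : 'I_(2 + k), t \in `]a, b[ -> derivable (fun t => c t 0 j) t 1).
  by apply: contrapT => H; apply: N't; left; apply: NP.
have dct : derivable c t 1.
  by apply/derivable_mxP => i j; rewrite (ord1 i); exact: dc.
set v := derive1 c t.
have tab' : t \in `[a, b] by exact: subset_itv_oo_cc tab.
have st0 := s0 _ tab'.
have dx : is_derive t (1:R) (fun t => xc (c t)) (xc v).
  by apply: DeriveDef; [exact: dc|rewrite -derive1E derive1_coord].
have dy : is_derive t (1:R) (fun t => yc (c t)) (yc v).
  by apply: DeriveDef; [exact: dc|rewrite -derive1E derive1_coord].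
have psi_t : psi t = (s t)^-1 * (xc v + yc v).
  rewrite -phiE derive1E.
  by have [_ ->] := is_derive1_comp (is_derive1_ln st0) (is_deriveD dx dy).
rewrite -EFinM lee_fin.
have -> : K * `|psi t| = Num.sqrt (c0 / 2 * psi t ^+ 2).
  by rewrite sqrtrM ?sqrtr_sqr// divr_ge0.
apply: ler_wsqrtr; have [x0 y0] := S0 _ (Sc _ tab').
apply: le_trans (gS _ v (Sc _ tab')).
have sumv : xc v ^+ 2 + yc v ^+ 2 <= \sum_i v 0 i ^+ 2.
  rewrite big_split_ord /= !big_ord_recl big_ord0 addr0.
  rewrite (_ : lshift k (lift ord0 ord0) = lshift k 1); last by apply/val_inj.
  by rewrite lerDl sumr_ge0// => i _; rewrite sqr_ge0.
set q := \sum_i _ in sumv *; set x := xc (c t) in x0 *; set y := yc (c t) in y0 *.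
have xy0 : 0 < x ^+ 2 + y ^+ 2 by rewrite addr_gt0// exprn_gt0.
rewrite psi_t exprMn exprVn /s -/x -/y -mulrA -[leRHS]mulrA ler_wpM2l//.
rewrite ler_pdivlMr//; set w := xc v + yc v.
have xy1 : (x ^+ 2 + y ^+ 2) * (x + y) ^- 2 <= 1.
  rewrite ler_pdivrMr ?exprn_gt0 ?addr_gt0// mul1r sqrrD.
  by rewrite lerD2r lerDl mulrn_wge0 ?mulr_ge0 ?ltW.
apply: (@le_trans _ _ (w ^+ 2 / 2)).
  rewrite [leLHS](_ : _ = (x ^+ 2 + y ^+ 2) * (x + y) ^- 2 * (w ^+ 2 / 2)); last by ring.
  by rewrite ler_piMl// divr_ge0 ?sqr_ge0.
apply: le_trans sumv; rewrite ler_pdivrMr// /w; have := sqr_ge0 (xc v - yc v); nra.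
Qed.

End CurveLength.

(** * The Dirac mass at the origin *)

Lemma integral_expRN_lty (R : realType) (a : R) :
  (\int[lebesgue_measure]_(x in `[a, +oo[) (expR (- x))%:E < +oo)%E.
Proof.
have dF (x : R) : is_derive x (1:R) (fun x => - expR (- x)) (expR (- x)).
  have dN := is_deriveN (is_derive_id x (1:R)).
  have [dexp dexpE] := is_deriveN (is_derive1_comp (is_derive_expR (- x)) dN).
  by apply: DeriveDef => //; rewrite dexpE mulrN mulr1 opprK.
have cF : continuous (fun x : R => - expR (- x)).
  by move=> x; apply/differentiable_continuous/derivable1_diffP; have [] := dF x.
rewrite (@ge0_continuous_FTC2y _ (fun x => expR (- x)) (fun x => - expR (- x)) a 0).
- by rewrite -EFinB ltry.
- by move=> x _; exact: expR_ge0.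
- apply: continuous_subspaceT => x.
  by apply: continuous_comp; [exact: opp_continuous|exact: continuous_expR].
- by rewrite -oppr0; apply: cvgN; exact: cvgr_expR.
- by move=> x _; have [] := dF x.
- by apply: cvg_at_right_filter; exact: cF.
- by move=> x _; rewrite derive1E; have [] := dF x.
Qed.

(** On a singleton every preimage is empty or the whole singleton, so any [f] is measurable
    there. *)
Lemma Rintegral_dirac_set1 d (T : measurableType d) (R : realType) (x : T) (f : T -> R) :
  measurable [set x] -> \int[\d_x]_(a in [set x]) f a = f x.
Proof.
move=> mx; rewrite /Rintegral integral_dirac//.
  by rewrite diracE mem_set// mul1e.
apply/measurable_EFinP => _ Y mY.
have [fY|fY] := pselect (Y (f x)).
- rewrite (_ : _ `&` _ = [set x])//; apply/seteqP; split=> [z []//|z ->].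
  by split.
- rewrite (_ : _ `&` _ = set0)//; apply/seteqP; split=> // z [-> //].
Qed.

Section DiracOrigin.
Context {R : realType}.
Local Notation origin := ((0, 0) : measurableTypeR R * measurableTypeR R).

Lemma measurable_origin : measurable [set origin].
Proof.
rewrite (_ : [set _] = [set 0] `*` [set 0]).
  by apply: measurableX; exact: measurable_set1.
by apply/seteqP; split=> [z ->|[z1 z2] [/= -> ->]].
Qed.

Lemma msupport_dirac_origin : msupport (\d_origin) = [set (0, 0)] :> set (R * R).
Proof.
apply/seteqP; split=> [a aS|_ -> O oO O0]; last by rewrite /= diracE mem_set.
apply: contrapT => a0.
have o0 : open (~` [set ((0, 0) : R * R)]).
  apply: closed_openC; apply: accessible_closed_set1; apply: hausdorff_accessible.
  exact: norm_hausdorff.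
have := aS _ o0 a0; rewrite /= diracE memNset ?ltxx//.
by move=> /=; apply.
Qed.

Lemma gmu_dirac_origin (k : nat) (u : R * R -> 'rV[R]_(2 + k) -> R)
    (g0 : 'rV[R]_(2 + k) -> 'M[R]_(2 + k)) p :
  gmu (\d_origin) u g0 p = u (0, 0) p *: g0 p.
Proof.
rewrite /gmu /Fmu msupport_dirac_origin; congr (_ *: _).
apply: etrans (@Rintegral_dirac_set1 _ (measurableTypeR R * measurableTypeR R)%type
  R origin
  (fun a : R * R => u a p * xc p `^ (- a.1) * yc p `^ (- a.2)) measurable_origin) _.
by rewrite /= oppr0 !powRr0 !mulr1.
Qed.

(** The square form makes the square root in the integral condition exactly [expR (- S)]. *)
Lemma Tmu_dirac_origin (S : R) : Tmu (\d_origin) S = expR (- S) ^+ 2.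
Proof.
rewrite /Tmu msupport_dirac_origin.
apply: etrans (@Rintegral_dirac_set1 _ (measurableTypeR R * measurableTypeR R)%type
  R origin
  (fun a : R * R => expR (- (S * (2 - a.1 - a.2)))) measurable_origin) _.
by rewrite /= !subr0 expr2 -expRD; congr expR; ring.
Qed.

End DiracOrigin.

Lemma qformZ (R : realType) (N : nat) (a : R) (A : 'M[R]_N) (v : 'rV[R]_N) :
  qform (a *: A) v = a * qform A v.
Proof. by rewrite /qform -scalemxAr -scalemxAl mxE. Qed.

Lemma qform_euclidean (R : realType) (N : nat) (p v : 'rV[R]_N) :
  qform (euclidean_metric p) v = \sum_i v 0 i ^+ 2.
Proof.
by rewrite /qform /euclidean_metric mulmx1 mxE; apply: eq_bigr => i _; rewrite mxE expr2.
Qed.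

Lemma ln_unbounded_near0 (R : realType) (M : R) :
  exists2 d : R, 0 < d & forall x, 0 < x -> x < d -> ln x < M.
Proof.
exists (expR M); first exact: expR_gt0.
by move=> x x0 xd; rewrite -(expRK M) ltr_ln ?posrE ?expR_gt0.
Qed.

(** * The corner is at infinite distance *)

Section CornerAtInfinity.
Context {R : realType} {k : nat}.
Variables (S : set 'rV[R]_(2 + k)) (g : 'rV[R]_(2 + k) -> 'M[R]_(2 + k)) (c0 : R).
Hypothesis c0_gt0 : 0 < c0.
Hypothesis S_gt0 : forall p, S p -> 0 < xc p /\ 0 < yc p.
Hypothesis g_ge : forall p (v : 'rV[R]_(2 + k)), S p ->
  c0 * (\sum_i v 0 i ^+ 2) / (xc p ^+ 2 + yc p ^+ 2) <= qform (g p) v.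

Let rho (p : 'rV[R]_(2 + k)) := xc p + yc p.
Let K := Num.sqrt (c0 / 2).

Let K_gt0 : 0 < K. Proof. by rewrite sqrtr_gt0 divr_gt0. Qed.

Let rho_gt0 p : S p -> 0 < rho p.
Proof. by move=> /S_gt0[x0 y0]; rewrite addr_gt0. Qed.

Let ln_rho_le_curve_length (I : set R) c s t : ac_curve I S c -> I s -> I t -> s <= t ->
  ((K * `|ln (rho (c t)) - ln (rho (c s))|)%:E <= curve_length g I c)%E.
Proof.
move=> [iI Sc acc] Is It st.
have stI : `[s, t]%classic `<=` I.
  by move=> z; rewrite /= in_itv /= => stz; exact: iI Is It _ stz.
apply: le_trans (curve_length_subset g c stI).
apply: ln_coord_sum_le_curve_length (ltW c0_gt0) st S_gt0 g_ge _.
split; first exact: interval_is_interval.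
- by move=> z /stI; exact: Sc.
- by move=> a b ab /subset_trans-/(_ _ stI); exact: acc.
Qed.

(** Directedness of the base [J] provides one tail on which both coordinates are below [d / 2]; this
    covers the left and right ends of [I] alike. *)
Let corner_along_rho (F : set_system R) (I : set R) (J : R -> set R) c :
  F = filter_from I J ->
  (forall t t', I t -> I t' -> exists2 t'', I t'' & J t'' `<=` J t `&` J t') ->
  corner_along F c -> forall d, 0 < d ->
  exists2 t, I t & forall z, J t z -> rho (c z) < d.
Proof.
move=> -> Jdir [xF yF] d d0; have d20 : 0 < d / 2 by rewrite divr_gt0.
have [t It xt] := xF _ (nbhsx_ballx 0 _ d20).
have [t' It' yt'] := yF _ (nbhsx_ballx 0 _ d20).
have [t'' It'' JJ] := Jdir _ _ It It'; exists t'' => // z /JJ[/xt + /yt'].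
rewrite /ball /= !sub0r !normrN => xz yz; rewrite /rho [ltRHS]splitr.
by apply: ltrD; [apply: le_lt_trans xz|apply: le_lt_trans yz]; exact: ler_norm.
Qed.

(** From a fixed time [t1], the change of [ln (rho (c t))] is unbounded towards the end at the
    corner, so the length exceeds every real [A]. *)
Lemma curve_length_corner (I : set R) c : ac_curve I S c ->
  corner_along (right_end I) c \/ corner_along (left_end I) c ->
  curve_length g I c = +oo%E.
Proof.
move=> acc corner_c; have [_ Sc _] := acc.
have smallP d : 0 < d -> (exists2 t, I t & forall z, I z -> t <= z -> rho (c z) < d) \/
    (exists2 t, I t & forall z, I z -> z <= t -> rho (c z) < d).
  move=> d0; case: corner_c => cc; [left|right].
  - have [|t It H] := corner_along_rho erefl _ cc d0.
      move=> t t' It It'; exists (Num.max t t'); first by case: leP.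
      by move=> z [Iz]; rewrite ge_max => /andP[].
    by exists t => // z Iz tz; exact: H.
  - have [|t It H] := corner_along_rho erefl _ cc d0.
      move=> t t' It It'; exists (Num.min t t'); first by case: leP.
      by move=> z [Iz]; rewrite le_min => /andP[].
    by exists t => // z Iz tz; exact: H.
have [t1 It1] : exists t1, I t1 by case: (smallP _ ltr01) => -[t It _]; exists t.
(* The threshold is chosen so that [rho (c t2) < d] makes [ln rho] drop by more than [A / K] from
   its value at [t1]. *)
apply/eqyP => A A0; have [d d0 dln] := ln_unbounded_near0 (ln (rho (c t1)) - A / K).
have far t2 : I t2 -> rho (c t2) < d -> A <= K * `|ln (rho (c t2)) - ln (rho (c t1))|.
  move=> It2 /(dln _ (rho_gt0 (Sc _ It2))) ln2.
  rewrite mulrC -ler_pdivrMr// distrC (le_trans _ (ler_norm _))// lerBrDl.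
  by move: ln2; rewrite ltrBrDr => /ltW; rewrite addrC.
case: (smallP d d0) => -[t0 It0 H].
(* The maximum lies both in the tail where [rho] is small and after [t1]; the other end uses the
   minimum. *)
- set t2 := Num.max t0 t1; have It2 : I t2 by rewrite /t2; case: leP.
  have := ln_rho_le_curve_length acc It1 It2; rewrite le_max lexx orbT => /(_ isT).
  by apply: le_trans; rewrite lee_fin far// H// le_max lexx.
- set t2 := Num.min t0 t1; have It2 : I t2 by rewrite /t2; case: leP.
  have := ln_rho_le_curve_length acc It2 It1; rewrite ge_min lexx orbT => /(_ isT).
  by apply: le_trans; rewrite lee_fin distrC far// H// ge_min lexx.
Qed.

Let rho_le_length_dist p q e : (length_dist S g p q < e%:E)%E ->
  K * `|ln (rho q) - ln (rho p)| < e.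
Proof.
move=> /ereal_inf_lt[_ [a [b [c [ab acc <- <- ->]]]]]; rewrite -lte_fin.
apply: le_lt_trans; apply: ln_rho_le_curve_length => //=.
- by rewrite in_itv /= lexx.
- by rewrite in_itv /= lexx ab.
Qed.

(** The tail of a Cauchy sequence stays within distance 1 of one of its terms, which bounds [ln rho]
    below along it; convergence to [p] would force [rho] to tend to 0. *)
Lemma completion_fibre_corner p : xc p = 0 -> yc p = 0 ->
  completion_fibre S (length_dist S g) p = set0.
Proof.
move=> xp yp; apply/seteqP; split=> // C [[s0 _ ->] [s [[Ss scauchy] _] sp]].
have [n0 H] := scauchy 1 ltr01.
have [d d0 dln] := ln_unbounded_near0 (ln (rho (s n0)) - 1 / K).
have d20 : 0 < d / 2 by rewrite divr_gt0.
have xs : xc (s n) @[n --> \oo] --> (0 : R).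
  rewrite -xp; exact: (cvg_comp _ _ sp (@coord_continuous _ _ _ 0 (lshift k 0) p)).
have ys : yc (s n) @[n --> \oo] --> (0 : R).
  rewrite -yp; exact: (cvg_comp _ _ sp (@coord_continuous _ _ _ 0 (lshift k 1) p)).
have [n [n0n xn yn]] : exists n, [/\ (n0 <= n)%N, xc (s n) < d / 2 & yc (s n) < d / 2].
  apply: (@filter_ex _ \oo); near=> n; split.
  - by near: n; exact: nbhs_infty_ge.
  - by near: n; apply: cvgr_lt xs _ _.
  - by near: n; apply: cvgr_lt ys _ _.
have rn : rho (s n) < d by rewrite [ltRHS]splitr ltrD.
have := rho_le_length_dist (H _ _ (leqnn _) n0n).
rewrite mulrC -ltr_pdivlMr//; have := dln _ (rho_gt0 (Ss n)) rn.
by rewrite distrC => h1 h2; have := ler_norm (ln (rho (s n0)) - ln (rho (s n))); lra.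
Unshelve. all: by end_near. Qed.

End CornerAtInfinity.

(** * The counterexample with the Dirac mass at the origin *)

Theorem proposition10p2 (R : realType) (k : nat) (V : set 'rV[R]_k)
    (eps : R) (g0 : 'rV[R]_(2 + k) -> 'M[R]_(2 + k)) (c0 C0 : R)
    (zB : 'rV[R]_k) (rB : R)
    (openV : open V)
    (heps : 0 < eps < 1)
    (hg0 : riemannian_metric (chart eps V) g0)
    (hc0 : 0 < c0) (hcC : c0 <= C0)
    (hlow : metric_le (chart eps V) (fun p => c0 *: euclidean_metric p) g0)
    (hupp : metric_le (chart eps V) g0 (fun p => C0 *: euclidean_metric p))
    (hrB : 0 < rB)
    (hBcompact : compact (closure (eball zB rB)))
    (hBV : closure (eball zB rB) `<=` V) :
  let B := eball zB rB in
  let UB := chart_interior eps B in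
  let mu := \d_((0, 0) : measurableTypeR R * measurableTypeR R) in
  let u := fun (_ : R * R) (p : 'rV[R]_(2 + k)) =>
             1 / (xc p ^+ 2 + yc p ^+ 2) in
  let g := gmu mu u g0 in
  [/\ msupport mu = [set (0, 0)],
      max_exponent mu 0,
      forall S0 : R, 0 <= S0 ->
        (\int[lebesgue_measure]_(S in `[S0, +oo[) (Num.sqrt (Tmu mu S))%:E
           = \int[lebesgue_measure]_(S in `[S0, +oo[) (expR (- S))%:E)%E /\
        (\int[lebesgue_measure]_(S in `[S0, +oo[) (expR (- S))%:E < +oo)%E,
      forall (I : set R) (c : R -> 'rV[R]_(2 + k)),
        approaches_corner eps B I c -> curve_length g I c = +oo%E &
      forall p : 'rV[R]_(2 + k), corner B p ->
        completion_fibre UB (length_dist UB g) p = set0].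
Proof.
move=> B UB mu u g.
have hB : B `<=` V by apply: subset_trans hBV; exact: subset_closure.
have UB0 p : UB p -> 0 < xc p /\ 0 < yc p by move=> [/andP[? _] /andP[? _] _].
have UBchart p : UB p -> chart eps V p.
  by move=> [/andP[/ltW x0 x1] /andP[/ltW y0 y1] /hB Vz]; split=> //; apply/andP.
(* For the Dirac mass at the origin the conformal factor is [u] itself, so the lower bound on [g0]
   rescales to the estimate required near the corner. *)
have g_ge p (v : 'rV[R]_(2 + k)) : UB p ->
    c0 * (\sum_i v 0 i ^+ 2) / (xc p ^+ 2 + yc p ^+ 2) <= qform (g p) v.
  move=> UBp; have [x0 y0] := UB0 _ UBp.
  rewrite /g gmu_dirac_origin qformZ /u mul1r mulrC.
  rewrite ler_wpM2l ?invr_ge0 ?addr_ge0 ?sqr_ge0//.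
  have := hlow p v (UBchart _ UBp).
  by rewrite qformZ qform_euclidean.
split.
- exact: msupport_dirac_origin.
- split; first by exists (0, 0); rewrite ?msupport_dirac_origin//= addr0.
  by move=> _ [a + <-]; rewrite msupport_dirac_origin => -> /=; rewrite addr0.
- move=> S0 _; split; last exact: integral_expRN_lty.
  apply: eq_integral => S _.
  by rewrite Tmu_dirac_origin sqrtr_sqr ger0_norm ?expR_ge0.
- by move=> I c [acc cc]; exact (curve_length_corner hc0 UB0 g_ge acc cc).
- by move=> p [xp yp _]; exact (completion_fibre_corner hc0 UB0 g_ge xp yp).
Qed.
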